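(* Let $a,b,c$ be indeterminates and define $G_n(a,b,c)$ by the formal power series identity $$\sum_{n\ge0}G_n(a,b,c)z^n=1+\sum_{n\ge1}z^n\prod_{k=0}^{n-1}\frac{a+bk}{1-c(k+1)z}.$$ Let $\alpha_{2n}=a+nb$ and $\alpha_{2n+1}=(c+b)(n+1)$ for $n\ge0$, and $\alpha_{-1}=0$. Then $$\sum_{n\ge0}G_n(a,b,c)z^n=\cfrac{1}{1-\cfrac{\alpha_0z}{1-\cfrac{\alpha_1z}{1-\cdots}}}=\cfrac{1}{1-(\alpha_{-1}+\alpha_0)z-\cfrac{\alpha_0\alpha_1z^2}{1-(\alpha_1+\alpha_2)z-\cfrac{\alpha_2\alpha_3z^2}{1-\cdots}}},$$ and $(G_n(a,b,c))_{n\ge0}$ is an $\mathbf{x}$-Stieltjes moment sequence and is $3$-$\mathbf{x}$-log-convex, where $\mathbf{x}=(a,b,c)$.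
   Context: A matrix is $\mathbf{x}$-TP if all its minors are polynomials in $\mathbf{x}$ with nonnegative coefficients; a sequence is an $\mathbf{x}$-Stieltjes moment sequence if its Hankel matrix $[\alpha_{i+j}]_{i,j\ge0}$ is $\mathbf{x}$-TP. Define $\mathcal{L}[\alpha_i]=\alpha_{i-1}\alpha_{i+1}-\alpha_i^2$ ($i\ge1$), $\mathcal{L}^m=\mathcal{L}(\mathcal{L}^{m-1})$; a sequence is $3$-$\mathbf{x}$-log-convex if $\mathcal{L}^m$ of it has nonnegative coefficients for $m\le3$ wherever defined. *)

(* Defs.v *)
From HB Require Import structures.
From mathcomp Require Import all_boot all_order all_algebra.
From mathcomp Require Import boolp.
From mathcomp Require Import mpoly.

Set Implicit Arguments.
Unset Strict Implicit.
Unset Printing Implicit Defensive.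

Import Order.TTheory GRing.Theory Num.Theory.
Local Open Scope ring_scope.

(* [Fps f] is the formal power series \sum_(n >= 0) f n z^n. *)
Record fps (A : Type) := Fps { fcoef :> nat -> A }.

HB.instance Definition _ (A : Type) := gen_eqMixin (fps A).
HB.instance Definition _ (A : Type) := gen_choiceMixin (fps A).

Lemma fpsP (A : Type) (f g : fps A) : fcoef f =1 fcoef g -> f = g.
Proof. by case: f g => [f] [g] /= /funext ->. Qed.

(* Convergence in the z-adic topology. *)
Definition fps_cvg (A : Type) (u : nat -> fps A) (f : fps A) : Prop :=
  forall m : nat, exists N : nat, forall n : nat, (N <= n)%N -> u n m = f m.

Section FpsRing.
Variable A : comNzRingType.
Implicit Types f g h : fps A.

Definition fps_zero : fps A := Fps (fun=> 0).
Definition fps_opp f : fps A := Fps (fun n => - f n).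
Definition fps_add f g : fps A := Fps (fun n => f n + g n).

Lemma fps_addA : associative fps_add.
Proof. by move=> f g h; apply: fpsP => n /=; rewrite addrA. Qed.
Lemma fps_addC : commutative fps_add.
Proof. by move=> f g; apply: fpsP => n /=; rewrite addrC. Qed.
Lemma fps_add0 : left_id fps_zero fps_add.
Proof. by move=> f; apply: fpsP => n /=; rewrite add0r. Qed.
Lemma fps_addN : left_inverse fps_zero fps_opp fps_add.
Proof. by move=> f; apply: fpsP => n /=; rewrite addNr. Qed.

HB.instance Definition _ :=
  GRing.isZmodule.Build (fps A) fps_addA fps_addC fps_add0 fps_addN.

Definition fpsC (c : A) : fps A := Fps (fun n => if n == 0%N then c else 0).
Definition fpsX : fps A := Fps (fun n => (n == 1%N)%:R).
Definition fps_mul f g : fps A :=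
  Fps (fun n => \sum_(i < n.+1) f i * g (n - i)%N).

Let T n f : {poly A} := \poly_(i < n.+1) f i.

Let coefT n f i : (i <= n)%N -> (T n f)`_i = f i.
Proof. by move=> le_in; rewrite coef_poly ltnS le_in. Qed.

Let fps_mulT n f g i : (i <= n)%N -> fps_mul f g i = (T n f * T n g)`_i.
Proof.
move=> le_in; rewrite coefM; apply: eq_bigr => j _.
rewrite !coefT //; first exact: leq_trans (leq_subr _ _) le_in.
by apply: leq_trans le_in; rewrite -ltnS.
Qed.

Lemma fps_mulA : associative fps_mul.
Proof.
move=> f g h; apply: fpsP => n.
transitivity ((T n f * (T n g * T n h))`_n).
  rewrite coefM; apply: eq_bigr => j _; rewrite coefT -1?ltnS //.
  by rewrite -fps_mulT // leq_subr.
rewrite mulrA coefM; apply: eq_bigr => j _; rewrite -fps_mulT -1?ltnS //.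
by rewrite coefT // leq_subr.
Qed.

Lemma fps_mulC : commutative fps_mul.
Proof. by move=> f g; apply: fpsP => n; rewrite !(@fps_mulT n) // mulrC. Qed.

Lemma fps_mul1 : left_id (fpsC 1) fps_mul.
Proof.
move=> f; apply: fpsP => n /=; rewrite big_ord_recl /= mul1r subn0.
by rewrite big1 ?addr0 // => i _; rewrite mul0r.
Qed.

Lemma fps_mulDl : left_distributive fps_mul fps_add.
Proof.
move=> f g h; apply: fpsP => n /=; rewrite -big_split /=.
by apply: eq_bigr => i _; rewrite mulrDl.
Qed.

Lemma fps_oner_neq0 : fpsC 1 != 0 :> fps A.
Proof.
apply/eqP => /(congr1 (fun f : fps A => f 0%N)) /= /eqP.
by rewrite oner_eq0.
Qed.

HB.instance Definition _ := GRing.Zmodule_isComNzRing.Build (fps A)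
  fps_mulA fps_mulC fps_mul1 fps_mulDl fps_oner_neq0.

Lemma fps_coefD f g n : (f + g) n = f n + g n. Proof. by []. Qed.
Lemma fps_coefN f n : (- f) n = - f n. Proof. by []. Qed.
Lemma fps_coefM f g n : (f * g) n = \sum_(i < n.+1) f i * g (n - i)%N.
Proof. by []. Qed.
Lemma fps_coef1 n : (1 : fps A) n = (n == 0%N)%:R.
Proof. by case: n. Qed.
Lemma fps_coef_sum I (r : seq I) (P : pred I) (F : I -> fps A) n :
  (\sum_(i <- r | P i) F i) n = \sum_(i <- r | P i) F i n.
Proof. by elim/big_rec2: _ => // i x y _ <-. Qed.
Lemma fps_coef0M f g : (f * g) 0%N = f 0%N * g 0%N.
Proof. by rewrite fps_coefM big_ord1. Qed.
Lemma fps_coefCM c f n : (fpsC c * f) n = c * f n.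
Proof.
rewrite fps_coefM big_ord_recl /= subn0 big1 ?addr0 // => i _.
by rewrite mul0r.
Qed.

Lemma fps_coefX_small g k n : g 0%N = 0 -> (n < k)%N -> (g ^+ k) n = 0.
Proof.
move=> g0; elim: k n => // k IHk n lt_nk; rewrite exprS fps_coefM.
rewrite big_ord_recl g0 mul0r add0r big1 // => i _.
rewrite IHk ?mulr0 // /bump /=.
by case: n i lt_nk => [[]//|n] i lt_nk; rewrite subSS (leq_ltn_trans (leq_subr _ _)).
Qed.

End FpsRing.

Section FpsUnit.
Variable A : comUnitRingType.
Implicit Types f g : fps A.

Definition fps_unit : pred (fps A) := fun f => f 0%N \is a GRing.unit.

(* 1 / f = u^-1 \sum_k (1 - u^-1 f)^k with u = f 0; the coefficient of z^n
   only involves the terms k <= n, since 1 - u^-1 f has zero constant term. *)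
Definition fps_inv f : fps A :=
  if fps_unit f then
    Fps (fun n => (f 0%N)^-1 *
           (\sum_(k < n.+1) (1 - fpsC (f 0%N)^-1 * f) ^+ k) n)
  else f.

Lemma fps_mulVr : {in fps_unit, left_inverse 1 fps_inv *%R}.
Proof.
move=> f; rewrite unfold_in /= => uf; rewrite /fps_inv /fps_unit uf.
set c := fpsC _; set g : fps A := 1 - c * f.
have g0 : g 0%N = 0 by rewrite /g fps_coefD fps_coefN fps_coefCM mulVr ?subrr.
apply: fpsP => n; rewrite fps_coefM /=.
pose S : fps A := \sum_(k < n.+1) g ^+ k.
transitivity ((c * S * f) n).
  rewrite fps_coefM; apply: eq_bigr => i _; congr (_ * _).
  rewrite fps_coefCM /S; congr (_ * _); rewrite !fps_coef_sum.
  have le_in : (i.+1 <= n.+1)%N by [].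
  rewrite (big_ord_widen _ (fun k => (g ^+ k) i) le_in) big_mkcond /=.
  apply: eq_bigr => k _; case: ltnP => // le_ik.
  by rewrite fps_coefX_small.
have -> : c * S * f = 1 - g ^+ n.+1.
  have -> : c * S * f = (1 - g) * S by rewrite /g opprB addrC subrK mulrAC.
  by rewrite /S -[RHS]opprB subrX1 -mulNr [- (g - 1)]opprB.
by rewrite fps_coefD fps_coefN fps_coefX_small // subr0.
Qed.

Lemma fps_unitP f g : g * f = 1 -> fps_unit f.
Proof.
move=> /(congr1 (fun h : fps A => h 0%N)); rewrite fps_coef0M fps_coef1 /= => gf.
by apply/unitrP; exists (g 0%N); split=> //; rewrite mulrC.
Qed.

Lemma fps_inv_out : {in [predC fps_unit], fps_inv =1 id}.
Proof. by move=> f nuf; rewrite /fps_inv ifN. Qed.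

HB.instance Definition _ :=
  GRing.ComNzRing_hasMulInverse.Build (fps A) fps_mulVr fps_unitP fps_inv_out.

(* The n-th convergents, with everything below the n-th level replaced by 0, of
     1 / (1 - s_0 z / (1 - s_1 z / (1 - ...)))   and
     1 / (1 - b_0 z - l_0 z^2 / (1 - b_1 z - l_1 z^2 / (1 - ...))).
   All denominators have constant coefficient 1, hence are units. *)
Fixpoint sfrac_conv (s : nat -> A) (n : nat) : fps A :=
  if n is n'.+1 then
    (1 - fpsC (s 0%N) * fpsX A * sfrac_conv (fun k => s k.+1) n')^-1
  else 0.

Fixpoint jfrac_conv (b l : nat -> A) (n : nat) : fps A :=
  if n is n'.+1 then
    (1 - fpsC (b 0%N) * fpsX A - fpsC (l 0%N) * fpsX A ^+ 2 *
       jfrac_conv (fun k => b k.+1) (fun k => l k.+1) n')^-1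
  else 0.

Definition eq_sfrac (f : fps A) (s : nat -> A) : Prop :=
  fps_cvg (sfrac_conv s) f.

Definition eq_jfrac (f : fps A) (b l : nat -> A) : Prop :=
  fps_cvg (jfrac_conv b l) f.

End FpsUnit.

Section XPositivity.
Variables (R : realDomainType) (n : nat).
Implicit Types (M : nat -> nat -> {mpoly R[n]}) (u : nat -> {mpoly R[n]}).

Definition coef_nonneg (p : {mpoly R[n]}) : Prop :=
  forall m : 'X_{1..n}, 0 <= p@_m.

Definition xTP M : Prop :=
  forall (k : nat) (r c : 'I_k -> nat),
    {homo r : i j / (i < j)%N} -> {homo c : i j / (i < j)%N} ->
    coef_nonneg (\det (\matrix_(i < k, j < k) M (r i) (c j))).

Definition x_stieltjes u : Prop := xTP (fun i j => u (i + j)%N).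

(* [iter m logL u] is meaningful only at the indices i >= m. *)
Definition logL u : nat -> {mpoly R[n]} :=
  fun i => u i.-1 * u i.+1 - u i ^+ 2.

Definition x_log_convex (k : nat) u : Prop :=
  forall m i : nat, (m <= k)%N -> (m <= i)%N -> coef_nonneg (iter m logL u i).

End XPositivity.

(* Main.v *)
Require Import Defs.
From HB Require Import structures.
From mathcomp Require Import all_boot all_order all_algebra.
From mathcomp Require Import perm mpoly.
From mathcomp Require Import ring zify.
Set Implicit Arguments.
Unset Strict Implicit.
Unset Printing Implicit Defensive.
Import Order.TTheory GRing.Theory Num.Theory.
Local Open Scope ring_scope.

(* Let [D m k] be the total weight of the Dyck prefixes from the origin to
   [(2m, 2k)], down steps from height [h + 1] having weight [alpha_h]. Expanding
   [D] on [S(m, N) c^(m - N)], with [S] the Stirling numbers of the second kind,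
   its coefficients are [C(N, j) prod_(j <= k < N) (a + b k)], as the one-step
   recurrence already holds for each [N]; hence [G m = D m 0]. The column
   generating functions of [D] then satisfy the Euler-Gauss recurrences of both
   continued fractions.
     Appending one step to the paths replaces each column by a nonnegative
   combination of itself and a neighbouring column, which preserves total
   positivity. Both [D] and the Hankel matrix of [G] are obtained in this way.
     Finally, the Desnanot-Jacobi identity turns the iterates of [logL] into sums
   of products of Hankel minors. *)

Section Cones.
Variables (R : realDomainType) (n : nat).
Implicit Types (p q : {mpoly R[n]}) (M : nat -> nat -> {mpoly R[n]}).

Lemma coef_nonneg0 : coef_nonneg (0 : {mpoly R[n]}).
Proof. by move=> m; rewrite mcoeff0. Qed.

Lemma coef_nonneg1 : coef_nonneg (1 : {mpoly R[n]}).
Proof. by move=> m; rewrite mcoeff1 ler0n. Qed.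

Lemma coef_nonnegX i : coef_nonneg ('X_i : {mpoly R[n]}).
Proof. by move=> m; rewrite mcoeffX ler0n. Qed.

Lemma coef_nonnegD p q : coef_nonneg p -> coef_nonneg q -> coef_nonneg (p + q).
Proof. by move=> hp hq m; rewrite mcoeffD addr_ge0. Qed.

Lemma coef_nonnegM p q : coef_nonneg p -> coef_nonneg q -> coef_nonneg (p * q).
Proof.
by move=> hp hq m; rewrite mcoeffM sumr_ge0 // => k _; rewrite mulr_ge0.
Qed.

Lemma coef_nonnegMn p k : coef_nonneg p -> coef_nonneg (p *+ k).
Proof. by move=> hp m; rewrite mcoeffMn mulrn_wge0. Qed.

Lemma coef_nonneg_sum I (r : seq I) (P : pred I) (F : I -> {mpoly R[n]}) :
  (forall i, P i -> coef_nonneg (F i)) -> coef_nonneg (\sum_(i <- r | P i) F i).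
Proof.
by move=> hF; apply: big_ind => //; [apply: coef_nonneg0 | apply: coef_nonnegD].
Qed.

Lemma coef_nonneg_prod I (r : seq I) (P : pred I) (F : I -> {mpoly R[n]}) :
  (forall i, P i -> coef_nonneg (F i)) -> coef_nonneg (\prod_(i <- r | P i) F i).
Proof.
by move=> hF; apply: big_ind => //; [apply: coef_nonneg1 | apply: coef_nonnegM].
Qed.

Lemma eq_xTP M M' : M =2 M' -> xTP M -> xTP M'.
Proof.
move=> eqM tpM k r c hr hc; have := tpM k r c hr hc.
by congr (coef_nonneg (\det _)); apply/matrixP=> i j; rewrite !mxE eqM.
Qed.

(* By multilinearity a minor expands into minors whose columns are weakly
   increasing; those with a repeated column vanish. *)
Lemma xTP_bidiag M (u v : nat -> nat) (p q : nat -> {mpoly R[n]}) :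
    (forall i j, (i < j)%N -> (maxn (u i) (v i) <= minn (u j) (v j))%N) ->
    (forall i, coef_nonneg (p i)) -> (forall i, coef_nonneg (q i)) ->
  xTP M -> xTP (fun i j => p j * M i (u j) + q j * M i (v j)).
Proof.
move=> uv hp hq tpM k r c hr hc; rewrite -det_tr.
pose w (f : {ffun 'I_k -> bool}) j := if f j then p (c j) else q (c j).
pose h (f : {ffun 'I_k -> bool}) j := if f j then u (c j) else v (c j).
have ->: \det (\matrix_(i < k, j < k)
    (p (c j) * M (r i) (u (c j)) + q (c j) * M (r i) (v (c j))))^T =
  \sum_(f : {ffun 'I_k -> bool}) (\prod_j w f j) *
     \det (\matrix_(i < k, j < k) M (r i) (h f j)).
  under [RHS]eq_bigr do rewrite -det_tr big_distrr /=.
  rewrite exchange_big; apply: eq_bigr => s _.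
  under [RHS]eq_bigr do rewrite mulrCA -big_split /=.
  rewrite -big_distrr /=; congr (_ * _).
  pose X (j : 'I_k) (b : bool) := (if b then p (c j) else q (c j)) *
     M (r (s j)) (if b then u (c j) else v (c j)).
  transitivity (\prod_j \sum_b X j b).
    by apply: eq_bigr => j _; rewrite !mxE big_bool.
  rewrite bigA_distr_bigA; apply: eq_bigr => f _; apply: eq_bigr => j _.
  by rewrite !mxE.
apply: coef_nonneg_sum => f _; apply: coef_nonnegM.
  by apply: coef_nonneg_prod => j _; rewrite /w; case: (f j).
have hh (i j : 'I_k) : (i < j)%N -> (h f i <= h f j)%N.
  move=> /hc /uv; rewrite geq_max !leq_min /h => /andP[/andP[? ?] /andP[? ?]].
  by case: (f i) (f j) => [] [].
have [inc|/forallPn[i /forallPn[j]]] :=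
  boolP [forall i : 'I_k, forall j : 'I_k, (i < j) ==> (h f i < h f j)]%N.
  by apply: tpM => // i j ij; move/forallP/(_ i)/forallP/(_ j)/implyP: inc; apply.
rewrite negb_imply -leqNgt => /andP[ij hji].
have hij : h f i = h f j by apply/eqP; rewrite eqn_leq hh.
rewrite -det_tr (@determinant_alternate _ _ _ i j) //; first exact: coef_nonneg0.
  by apply/eqP => eij; rewrite eij ltnn in ij.
by move=> l; rewrite !mxE hij.
Qed.

Lemma xTP0 : xTP (fun _ _ => 0 : {mpoly R[n]}).
Proof.
move=> [|k] r c _ _; first by rewrite det_mx00; apply: coef_nonneg1.
by rewrite (_ : \matrix_(i, j) _ = 0) ?det0; [apply: coef_nonneg0 |
  apply/matrixP => i j; rewrite !mxE].
Qed.

Lemma xTP_consrow M :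
  xTP M -> xTP (fun i j => if i is i'.+1 then M i' j else (j == 0%N)%:R).
Proof.
move=> tpM [|k] r c hr hc; first by rewrite det_mx00; apply: coef_nonneg1.
have gt0 (f : 'I_k.+1 -> nat) : {homo f : i j / (i < j)%N} ->
    forall i : 'I_k, (0 < f (lift ord0 i))%N.
  by move=> hf i; apply: leq_ltn_trans (hf ord0 (lift ord0 i) _).
have [r0|r0] := posnP (r ord0); last first.
  have rgt0 i : (0 < r i)%N.
    by case: (unliftP ord0 i) => [j ->|->] //; apply: gt0.
  have := tpM k.+1 (fun i => (r i).-1) c _ hc.
  rewrite (_ : \matrix_(i, j) M (r i).-1 (c j) = \matrix_(i, j)
    (match r i with i'.+1 => M i' (c j) | 0%N => (c j == 0%N)%:R end)).
    by apply=> i j ij; move: (hr _ _ ij) (rgt0 i); case: (r i) (r j) => [|?] [].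
  by apply/matrixP => i j; rewrite !mxE; case: (r i) (rgt0 i).
rewrite (expand_det_row _ ord0) big_ord_recl big1 => [|j _]; last first.
  by rewrite mxE r0; have := gt0 c hc j; case: (c _) => // ? _; rewrite mul0r.
rewrite addr0 mxE r0; apply: coef_nonnegM.
  by case: (_ == _); [apply: coef_nonneg1 | apply: coef_nonneg0].
rewrite /cofactor /= addn0 expr0 mul1r.
have homo_lift (f : 'I_k.+1 -> nat) : {homo f : i j / (i < j)%N} ->
    {homo (fun i => f (lift ord0 i)) : i j / (i < j)%N}.
  by move=> hf i j ij; apply: hf; rewrite /= /bump /= ltnS.
rewrite (_ : row' _ _ = \matrix_(i, j) M (r (lift ord0 i)).-1 (c (lift ord0 j))).
  apply: tpM; last exact: homo_lift.
  move=> i j ij; move: (homo_lift r hr _ _ ij) (gt0 r hr i) (gt0 r hr j).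
  by case: (r _) (r _) => [|?] [].
apply/matrixP => i j; rewrite !mxE.
by have := gt0 r hr i; case: (r _).
Qed.

Lemma xTP_rows M :
  (forall N : nat, xTP (fun i j => if (i < N)%N then M i j else 0)) -> xTP M.
Proof.
move=> tpM k r c hr hc; have := tpM (\max_i (r i).+1) k r c hr hc.
congr (coef_nonneg (\det _)); apply/matrixP => i j; rewrite !mxE.
by rewrite (leq_bigmax (F := fun i => (r i).+1) i).
Qed.

Lemma xTP_cols M (W : nat -> nat -> nat -> {mpoly R[n]}) :
    (forall N, xTP (W N)) -> (forall N i j, (j < N)%N -> W N i j = M i j) ->
  xTP M.
Proof.
move=> tpW WM k r c hr hc; have := tpW (\max_i (c i).+1) k r c hr hc.
congr (coef_nonneg (\det _)); apply/matrixP => i j; rewrite !mxE WM //.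
exact: (leq_bigmax (F := fun i => (c i).+1) j).
Qed.

End Cones.

(* [srow s m k] is the weight of the Dyck prefixes ending at [(2m, 2k)], where
   a down step from height [h + 1] has weight [s h]; [odd_step] and
   [even_step] append one step to prefixes of even and of odd length. *)
Section DyckPrefixes.
Variables (A : comPzRingType) (s : nat -> A).

Definition odd_step (v : nat -> A) (k : nat) : A :=
  v k + s k.*2.+1 * v k.+1.

Definition even_step (v : nat -> A) (k : nat) : A :=
  (if k is k'.+1 then v k' else 0) + s k.*2 * v k.

Fixpoint srow (m : nat) : nat -> A :=
  if m is m'.+1 then even_step (odd_step (srow m'))
  else fun k => (k == 0%N)%:R.

Lemma srow_gt m k : (m < k)%N -> srow m k = 0.
Proof.
elim: m k => [|m IHm] [|k] //= lt_mk.
rewrite /even_step /odd_step /= !IHm ?mulr0 ?addr0 ?mulr0 //.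
all: by [rewrite ?addr0 | lia].
Qed.

Lemma srow_diag m : srow m m = 1.
Proof.
elim: m => [|m IHm] //=.
rewrite /even_step /odd_step /= IHm !srow_gt ?mulr0 ?addr0 ?mulr0 ?addr0 //.
all: by [rewrite ?addr0 | lia].
Qed.

End DyckPrefixes.

Section StieltjesTP.
Variables (R : realDomainType) (n : nat) (s : nat -> {mpoly R[n]}).
Hypothesis s_ge0 : forall k, coef_nonneg (s k).

Lemma xTP_odd_step M : xTP M -> xTP (fun i => odd_step s (M i)).
Proof.
move=> tpM; apply: eq_xTP (xTP_bidiag (u := id) (v := S) (p := fun=> 1)
    (q := fun j => s j.*2.+1) _ _ _ tpM) => [i j|i j||i] //.
- by rewrite /odd_step mul1r.
- lia.
- by move=> ?; apply: coef_nonneg1.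
Qed.

Lemma xTP_even_step M : xTP M -> xTP (fun i => even_step s (M i)).
Proof.
move=> tpM; apply: eq_xTP (xTP_bidiag (u := predn) (v := id)
    (p := fun j => (j != 0)%N%:R) (q := fun j => s j.*2) _ _ _ tpM)
    => [i [|j]|i j|[|i]|i] //.
- by rewrite /even_step mul0r.
- by rewrite /even_step mul1r.
- lia.
- exact: coef_nonneg0.
- exact: coef_nonneg1.
Qed.

Lemma xTP_srow : xTP (srow s).
Proof.
apply: xTP_rows; elim=> [|N IHN]; first by apply: eq_xTP (@xTP0 R n).
apply: eq_xTP (xTP_consrow (xTP_even_step (xTP_odd_step IHN))) => -[|i] j //=.
rewrite ltnS; case: ifP => // _.
by case: j => *; rewrite /even_step /odd_step !mulr0 !addr0 !mulr0 ?addr0.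
Qed.

(* Interpolates between the triangular matrix [srow s] and the Hankel matrix
   of [srow s ^~ 0]. *)
Lemma xTP_srow_hankel_upto N :
  xTP (fun i j =>
    if (j < N)%N then srow s (i + j) 0 else srow s (i + N) (j - N)).
Proof.
elim: N => [|N IHN].
  by apply: eq_xTP xTP_srow => i j; rewrite addn0 subn0.
have uv i j : (i < j)%N -> (maxn i.-1 i <= minn j.-1 j)%N by lia.
have tpO := xTP_bidiag (p := fun j => (N < j)%N%:R)
  (q := fun j => if (j <= N)%N then 1 else s (j - N.+1).*2.+1) uv _ _ IHN.
have tpE := xTP_bidiag (p := fun j => (N.+1 < j)%N%:R)
  (q := fun j => if (j <= N)%N then 1 else s (j - N.+1).*2) uv _ _ (tpO _ _).
apply: eq_xTP (tpE _ _ _ _) => [i j|j|j|j|j]; last first.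
- by case: ifP => // _; apply: coef_nonneg1.
- by case: ltnP => _; [apply: coef_nonneg1 | apply: coef_nonneg0].
- by case: ifP => // _; apply: coef_nonneg1.
- by case: ltnP => _; [apply: coef_nonneg1 | apply: coef_nonneg0].
have [lejN|ltNj] := leqP j N.
  rewrite (_ : (N.+1 < j)%N = false) /= ?mul0r ?add0r ?mul1r; last by lia.
  by rewrite ltnS lejN; case: ltngtP lejN => // -> _; rewrite subnn.
have [k ->] : exists k, j = (N.+1 + k)%N by exists (j - N.+1)%N; lia.
rewrite addKn (_ : (N.+1 + k - N)%N = k.+1); last by lia.
rewrite (_ : (N.+1 + k < N)%N = false); last by lia.
rewrite (_ : (N.+1 + k < N.+1)%N = false); last by lia.
rewrite addnS /= /even_step /odd_step mul1r.
case: k => [|k].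
  by rewrite !addn0 !ltnn subnn mul0r.
have -> : (N.+1 < N.+1 + k.+1)%N by lia.
have -> : (N < N + k.+1)%N by lia.
have -> : (N + k.+1 < N)%N = false by lia.
have -> : (N + k.+1 <= N)%N = false by lia.
have -> : (N + k.+1 - N.+1)%N = k by lia.
rewrite addKn addnS /= ltnNge leq_addr /= addKn.
by rewrite !mul1r.
Qed.

Lemma xTP_srow_hankel : x_stieltjes (srow s ^~ 0%N).
Proof.
apply: (xTP_cols xTP_srow_hankel_upto) => N i j lt_jN.
by rewrite lt_jN.
Qed.

End StieltjesTP.

Section SmallDeterminants.
Variable A : comPzRingType.

Lemma det_nat_expand k (g : nat -> nat -> A) :
  \det (\matrix_(i < k.+1, j < k.+1) g i j) =
  \sum_(j < k.+1) g 0%N j *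
    ((-1) ^+ j * \det (\matrix_(i < k, l < k) g i.+1 (bump j l))).
Proof.
rewrite (expand_det_row _ ord0); apply: eq_bigr => j _; rewrite mxE.
congr (_ * (_ * \det _)).
by apply/matrixP => i l; rewrite !mxE /= /bump /= add1n.
Qed.

Lemma det_nat2 (g : nat -> nat -> A) :
  \det (\matrix_(i < 2, j < 2) g i j) =
  g 0%N 0%N * g 1%N 1%N - g 0%N 1%N * g 1%N 0%N.
Proof.
rewrite det_nat_expand !big_ord_recl big_ord0 !det_mx11 !mxE /= /bump /=.
by rewrite !(add0n, addn0, addn1); ring.
Qed.

Lemma det_nat3 (g : nat -> nat -> A) :
  \det (\matrix_(i < 3, j < 3) g i j) =
  g 0%N 0%N * (g 1%N 1%N * g 2%N 2%N - g 1%N 2%N * g 2%N 1%N) -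
  g 0%N 1%N * (g 1%N 0%N * g 2%N 2%N - g 1%N 2%N * g 2%N 0%N) +
  g 0%N 2%N * (g 1%N 0%N * g 2%N 1%N - g 1%N 1%N * g 2%N 0%N).
Proof.
rewrite det_nat_expand !big_ord_recl big_ord0.
rewrite !(det_nat2 (fun i l => g i.+1 (bump _ l))) /= /bump /=.
by rewrite !(add0n, addn0, addn1, add1n); ring.
Qed.

Lemma det_nat4 (g : nat -> nat -> A) :
  let m j k l := g 1%N j * (g 2%N k * g 3%N l - g 2%N l * g 3%N k) -
    g 1%N k * (g 2%N j * g 3%N l - g 2%N l * g 3%N j) +
    g 1%N l * (g 2%N j * g 3%N k - g 2%N k * g 3%N j) in
  \det (\matrix_(i < 4, j < 4) g i j) =
  g 0%N 0%N * m 1%N 2%N 3%N - g 0%N 1%N * m 0%N 2%N 3%N +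
  g 0%N 2%N * m 0%N 1%N 3%N - g 0%N 3%N * m 0%N 1%N 2%N.
Proof.
rewrite det_nat_expand !big_ord_recl big_ord0.
rewrite !(det_nat3 (fun i l => g i.+1 (bump _ l))) /= /bump /=.
by rewrite !(add0n, addn0, addn1, add1n) /=; ring.
Qed.

End SmallDeterminants.

Section LogConvex.
Variables (R : realDomainType) (n : nat).

Lemma x_stieltjes_log_convex3 (u : nat -> {mpoly R[n]}) :
  x_stieltjes u -> x_log_convex 3 u.
Proof.
move=> tpu.
have hankel k (p : nat) :
    coef_nonneg (\det (\matrix_(i < k, j < k) u (p + i + j)%N)).
  by apply: (tpu k (fun i => p + i)%N val) => // i j ij; rewrite ltn_add2l.
have h1 (p : nat) : coef_nonneg (u p).
  by have := hankel 1%N p; rewrite det_mx11 mxE !addn0.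
pose d2 (p : nat) := u p * u p.+2 - u p.+1 ^+ 2.
pose d3 (p : nat) := u p * d2 p.+2 -
  u p.+1 * (u p.+1 * u p.+4 - u p.+2 * u p.+3) +
  u p.+2 * (u p.+1 * u p.+3 - u p.+2 ^+ 2).
pose d4 (p : nat) : {mpoly R[n]} :=
  \det (\matrix_(i < 4, j < 4) u (p + i + j)%N).
have h2 (p : nat) : coef_nonneg (d2 p).
  have := hankel 2%N p; rewrite (det_nat2 (fun i j => u (p + i + j)%N)).
  by rewrite !addnS !addn0 /d2 expr2.
have h3 (p : nat) : coef_nonneg (d3 p).
  have := hankel 3%N p; rewrite (det_nat3 (fun i j => u (p + i + j)%N)).
  by rewrite !addnS !addn0 /d3 /d2; congr coef_nonneg; ring.
(* Desnanot-Jacobi for the 4 x 4 Hankel minor, whose central 2 x 2 minor is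
   [d2 p.+2]. *)
have d4E (p : nat) : d2 p.+2 * d4 p = d3 p * d3 p.+2 - d3 p.+1 ^+ 2.
  rewrite /d4 (det_nat4 (fun i j => u (p + i + j)%N)) !addnS !addn0 /d3 /d2.
  ring.
have L1 i : logL u i.+1 = d2 i by [].
have L2 i : logL (logL u) i.+2 = u i.+2 * d3 i.
  by rewrite /logL /= /d3 /d2; ring.
have L3 i : logL (logL (logL u)) i.+3 = d2 i.+2 * d3 i * d3 i.+2 +
    u i.+3 ^+ 2 * (d2 i.+2 * d4 i).
  by rewrite {1}/logL /= !L2 d4E {1}/d2; ring.
case=> [|[|[|[|m]]]] [|[|[|i]]] //= _ _; rewrite ?L1 ?L2 ?L3 //.
- exact: coef_nonnegM.
- exact: coef_nonnegM.
- apply: coef_nonnegD; first by do 2?apply: coef_nonnegM.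
  by rewrite expr2; do 2?apply: coef_nonnegM => //; apply: hankel.
Qed.

End LogConvex.

Section StirlingExpansion.
Variables (A : comPzRingType) (a b c : A) (s : nat -> A).
Hypothesis s_even : forall n, s n.*2 = a + b *+ n.
Hypothesis s_odd : forall n, s n.*2.+1 = (c + b) *+ n.+1.

(* [cstirling m n = S(m, n) c^(m - n)] with [S] the Stirling numbers of the
   second kind. *)
Fixpoint cstirling (m n : nat) : A :=
  match m, n with
  | 0, 0 => 1
  | m'.+1, n'.+1 => cstirling m' n' + c *+ n * cstirling m' n
  | _, _ => 0
  end.

Lemma cstirling_gt m n : (m < n)%N -> cstirling m n = 0.
Proof.
by elim: m n => [|m IHm] [|n] //= lt_mn; rewrite !IHm ?mulr0 ?addr0 //; lia.
Qed.

Definition rising_coef (N j : nat) : A :=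
  (\prod_(j <= k < N) (a + b *+ k)) *+ 'C(N, j).

Lemma rising_coef_step N j :
  rising_coef N.+1 j + c *+ N * rising_coef N j =
  even_step s (odd_step s (rising_coef N)) j.
Proof.
rewrite /even_step /odd_step s_even.
have [lt_Nj|le_jN] := ltnP N j.
  case: j lt_Nj => // j; rewrite ltnS leq_eqVlt => /predU1P[<-|lt_Nj].
    rewrite /rising_coef !binn !big_geq; try lia.
    rewrite !bin_small; try lia.
    by rewrite !mulr0n !mulr0 !addr0 ?mulr0 ?addr0.
  rewrite /rising_coef !bin_small; try lia.
  by rewrite !mulr0n !mulr0 !addr0 ?mulr0 ?addr0.
have [d ->] : exists d, N = (j + d)%N by exists (N - j)%N; lia.
pose P := \prod_(j <= k < j + d) (a + b *+ k).
have PS : \prod_(j <= k < (j + d).+1) (a + b *+ k) = P * (a + b *+ (j + d)).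
  by rewrite big_nat_recr //= leq_addr.
have X1 : (a + b *+ j) * (s j.*2.+1 * rising_coef (j + d) j.+1) =
    (c + b) * P *+ d *+ 'C(j + d, j).
  rewrite s_odd /rising_coef -(mulr_natr _ 'C(_, _)) -mulrnA.
  have -> : (d * 'C(j + d, j) = j.+1 * 'C(j + d, j.+1))%N.
    by rewrite mul_bin_left addKn.
  case: d @P {PS} => [|d] P.
    by rewrite addn0 bin_small // muln0 !mulr0.
  rewrite /P (big_ltn (m := j)); last by lia.
  by rewrite mulrnA; clear P;
    move: (\prod_(_ <= _ < _) _) 'C(_, _) => Q B; ring.
rewrite mulrDr X1 {X1}.
case: j @P PS le_jN => [|j] P PS _ /=.
  rewrite /rising_coef PS !bin0 -/P /=; ring.
rewrite /rising_coef PS binS -/P s_odd big_ltn; last by lia.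
rewrite -/P.
have := mul_bin_left (j.+1 + d) j.
rewrite (_ : (j.+1 + d - j = d.+1)%N); last by lia.
move=> /(congr1 (fun k => k%:R : A)); rewrite !natrM => H.
clearbody P; clear PS.
move: 'C(_, j.+1) 'C(_, j) H => B1 B2 H.
have {}H : j%:R * B1%:R = (d.+1)%:R * B2%:R - B1%:R :> A by rewrite -H; ring.
ring: H.
Qed.

Lemma even_odd_step_sum I (r : seq I) (x : I -> A) (v : I -> nat -> A) j :
  even_step s (odd_step s (fun k => \sum_(i <- r) x i * v i k)) j =
  \sum_(i <- r) x i * even_step s (odd_step s (v i)) j.
Proof.
elim: r => [|i r IHr] in j *.
  by case: j => *; rewrite /even_step /odd_step !big_nil !(mulr0, addr0).
rewrite big_cons -IHr /even_step /odd_step.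
by case: j => *; rewrite !big_cons; ring.
Qed.

Lemma eq_even_odd_step (v w : nat -> A) :
  v =1 w -> even_step s (odd_step s v) =1 even_step s (odd_step s w).
Proof. by move=> vw [|j]; rewrite /even_step /odd_step !vw. Qed.

Lemma srow_stirling m j :
  srow s m j = \sum_(N < m.+1) cstirling m N * rising_coef N j.
Proof.
elim: m j => [|m IHm] j.
  rewrite big_ord1 /= mul1r /rising_coef big_geq //.
  by case: j.
rewrite /= (eq_even_odd_step IHm) even_odd_step_sum.
rewrite [RHS]big_ord_recl /= mul0r add0r.
under eq_bigr do rewrite -rising_coef_step mulrDr.
under [RHS]eq_bigr do rewrite mulrDl.
rewrite !big_split /=; congr (_ + _).
transitivity (\sum_(N < m.+2) c *+ N * cstirling m N * rising_coef N j).
  rewrite [RHS]big_ord_recr /= cstirling_gt // mulr0 mul0r addr0.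
  by apply: eq_bigr => N _; ring.
by rewrite big_ord_recl mulr0n !mul0r add0r.
Qed.

Lemma srow_stirling0 m :
  srow s m 0 = \sum_(N < m.+1) cstirling m N * \prod_(0 <= k < N) (a + b *+ k).
Proof.
by rewrite srow_stirling; apply: eq_bigr => N _; rewrite /rising_coef bin0.
Qed.

End StirlingExpansion.

Section ContinuedFractions.
Variable A : comUnitRingType.
Implicit Types (f g h : fps A).

Local Notation z := (fpsX A).

Lemma fpsCD (x y : A) : fpsC (x + y) = fpsC x + fpsC y :> fps A.
Proof. by apply: fpsP => -[|m] //=; rewrite addr0. Qed.

Lemma fpsCM (x y : A) : fpsC (x * y) = fpsC x * fpsC y :> fps A.
Proof.
by apply: fpsP => m; rewrite fps_coefCM; case: m => //=; rewrite mulr0.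
Qed.

Lemma fps_coefXM0 f : (z * f) 0%N = 0.
Proof. by rewrite fps_coef0M mul0r. Qed.

Lemma fps_coefXMS f m : (z * f) m.+1 = f m.
Proof.
rewrite fps_coefM !big_ord_recl /= mul0r add0r mul1r subSS subn0.
by rewrite big1 ?addr0 // => i _; rewrite mul0r.
Qed.

Lemma fps_coefXnM_lt k f m : (m < k)%N -> (z ^+ k * f) m = 0.
Proof.
elim: k m => // k IHk [|m] lt_mk; rewrite exprS -mulrA ?fps_coefXM0 //.
by rewrite fps_coefXMS IHk.
Qed.

Lemma fps_unit_coef0 f : f 0%N = 1 -> f \is a GRing.unit.
Proof. by move=> f0; rewrite unfold_in /= /fps_unit f0 unitr1. Qed.

(* Both types of continued fractions have partial denominators
   [d_k - z v_k (...)] with [d_k = 1 + O(z)]. *)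
Fixpoint gfrac_conv (d v : nat -> fps A) (n : nat) : fps A :=
  if n is n'.+1 then
    (d 0%N - z * v 0%N * gfrac_conv (d \o S) (v \o S) n')^-1
  else 0.

Lemma sfrac_convE (s : nat -> A) n :
  sfrac_conv s n = gfrac_conv (fun=> 1) (fun k => fpsC (s k)) n.
Proof. by elim: n s => //= n IHn s; rewrite IHn [z * _]mulrC. Qed.

Lemma jfrac_convE (b l : nat -> A) n :
  jfrac_conv b l n =
  gfrac_conv (fun k => 1 - fpsC (b k) * z) (fun k => fpsC (l k) * z) n.
Proof.
elim: n b l => //= n IHn b l; rewrite IHn.
by rewrite !mulrA -[z * _ * z]mulrA [z * (_ * z)]mulrC.
Qed.

(* The method of Euler and Gauss: the recurrence says that
   [h_(k+1) / h_k = 1 / (d_k - z v_k h_(k+2) / h_(k+1))]. *)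
Lemma gfrac_conv_mod (d v h : nat -> fps A) n k :
    (forall k, d k 0%N = 1) -> (forall k, h k 0%N = 1) ->
    (forall k, h k = d k * h k.+1 - z * v k * h k.+2) ->
  exists w, gfrac_conv (fun i => d (k + i)%N) (fun i => v (k + i)%N) n =
    h k.+1 / h k + z ^+ n * w.
Proof.
move=> d0 h0 hE; have uh i := fps_unit_coef0 (h0 i).
elim: n k => [|n IHn] k.
  by exists (- (h k.+1 / h k)); rewrite mul1r subrr.
have [w IHw] := IHn k.+1.
rewrite /= addn0.
have -> : gfrac_conv ((fun i => d (k + i)%N) \o S) ((fun i => v (k + i)%N) \o S) n
  = h k.+2 / h k.+1 + z ^+ n * w.
  by rewrite -IHw; congr gfrac_conv; apply: boolp.funext => i; rewrite /= addnS.
set D := _ - _.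
have uD : D \is a GRing.unit.
  by apply: fps_unit_coef0; rewrite fps_coefD fps_coefN -mulrA fps_coefXM0 subr0.
have hD : D * h k.+1 = h k - z ^+ n.+1 * (v k * w * h k.+1).
  rewrite /D [h k]hE mulrBl mulrDr mulrDl.
  rewrite -[z * v k * _ * h k.+1]mulrA divrK // exprS; ring.
exists (v k * w * h k.+1 / h k / D).
apply: (mulrI uD); rewrite divrr // mulrDr [D * (h _ / _)]mulrA hD.
apply: (mulIr (uh k)); rewrite mul1r.
rewrite mulrDl divrK //.
transitivity (h k - z ^+ n.+1 * (v k * w * h k.+1) +
   z ^+ n.+1 * (v k * w * h k.+1) * (D / D) * (h k / h k)).
  by rewrite !divrr // !mulr1 subrK.
ring.
Qed.

Lemma gfrac_conv_cvg (d v h : nat -> fps A) :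
    (forall k, d k 0%N = 1) -> (forall k, h k 0%N = 1) -> h 0%N = 1 ->
    (forall k, h k = d k * h k.+1 - z * v k * h k.+2) ->
  fps_cvg (gfrac_conv d v) (h 1%N).
Proof.
move=> d0 h0 h01 hE m; exists m.+1 => n lt_mn.
have [w] := gfrac_conv_mod n 0 d0 h0 hE; rewrite h01 divr1 => ->.
by rewrite fps_coefD fps_coefXnM_lt // addr0.
Qed.

Variable s : nat -> A.

Definition even_column k : fps A := Fps (fun m => srow s (m + k) k).
Definition odd_column k : fps A :=
  Fps (fun m => odd_step s (srow s (m + k)) k).

Lemma odd_columnE k :
  odd_column k = even_column k + fpsC (s k.*2.+1) * (z * even_column k.+1).
Proof.
apply: fpsP => m; rewrite fps_coefD fps_coefCM.
case: m => [|m]; rewrite ?fps_coefXM0 ?fps_coefXMS /= /odd_step ?addnS //.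
by rewrite (@srow_gt _ _ _ k.+1).
Qed.

Lemma even_column0E :
  even_column 0 = 1 + fpsC (s 0%N) * (z * odd_column 0).
Proof.
apply: fpsP => m; rewrite fps_coefD fps_coefCM fps_coef1.
case: m => [|m]; first by rewrite fps_coefXM0 mulr0 addr0.
by rewrite fps_coefXMS.
Qed.

Lemma even_columnSE k :
  even_column k.+1 = odd_column k + fpsC (s k.+1.*2) * (z * odd_column k.+1).
Proof.
apply: fpsP => m; rewrite fps_coefD fps_coefCM.
case: m => [|m]; first last.
  by rewrite fps_coefXMS /= !addnS.
rewrite fps_coefXM0 /= /even_step /odd_step !add0n.
rewrite (@srow_gt _ _ _ k.+1) // (@srow_gt _ _ _ k.+2) //.
by rewrite !(mulr0, addr0).
Qed.

Lemma even_column_coef0 k : even_column k 0%N = 1.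
Proof. by rewrite /= add0n srow_diag. Qed.

Lemma odd_column_coef0 k : odd_column k 0%N = 1.
Proof. by rewrite /= /odd_step add0n srow_diag srow_gt // mulr0 addr0. Qed.

Lemma srow_sfrac : eq_sfrac (Fps (srow s ^~ 0%N)) s.
Proof.
pose h k := if k is k'.+1 then
  if odd k' then odd_column k'./2 else even_column k'./2 else 1.
have -> : Fps (srow s ^~ 0%N) = h 1%N by apply: fpsP => m; rewrite /= addn0.
rewrite /eq_sfrac (_ : sfrac_conv s = gfrac_conv (fun=> 1) (fun k => fpsC (s k))).
  apply: gfrac_conv_cvg => // [k|k].
    case: k => //= k; case: ifP => _.
      exact: odd_column_coef0.
    exact: even_column_coef0.
  case: k => [|k]; first by rewrite /h /= even_column0E; ring.
  rewrite -(odd_double_half k); case: (odd k);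
    rewrite /= !odd_double ?uphalf_double !doubleK /=.
    by rewrite even_columnSE doubleS; ring.
  by rewrite odd_columnE; ring.
by apply: boolp.funext => n; rewrite sfrac_convE.
Qed.

Lemma srow_jfrac :
  eq_jfrac (Fps (srow s ^~ 0%N))
    (fun k => (if k is k'.+1 then s k'.*2.+1 else 0) + s k.*2)
    (fun k => s k.*2 * s k.*2.+1).
Proof.
pose h k := if k is k'.+1 then even_column k' else 1.
have -> : Fps (srow s ^~ 0%N) = h 1%N by apply: fpsP => m; rewrite /= addn0.
set b := fun k => _ + _; set l := fun k => _ * _.
rewrite /eq_jfrac (_ : jfrac_conv b l =
  gfrac_conv (fun k => 1 - fpsC (b k) * z) (fun k => fpsC (l k) * z)).
  apply: gfrac_conv_cvg => // [k|[|k]|k].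
  - by rewrite fps_coefD fps_coefN mulrC fps_coefXM0 subr0.
  - by [].
  - exact: even_column_coef0.
  rewrite /b /l fpsCD fpsCM; case: k => [|k] /=.
    have -> : fpsC 0 = 0 :> fps A by apply: fpsP => -[].
    transitivity (even_column 0 - fpsC (s 0) * (z * odd_column 0)).
      by rewrite {1}even_column0E; ring.
    by rewrite odd_columnE; ring.
  transitivity (odd_column k - fpsC (s k.*2.+1) * (z * even_column k.+1)).
    by rewrite odd_columnE; ring.
  have -> : odd_column k =
      even_column k.+1 - fpsC (s k.+1.*2) * (z * odd_column k.+1).
    by rewrite even_columnSE; ring.
  by rewrite odd_columnE; ring.
by apply: boolp.funext => n; rewrite jfrac_convE.
Qed.

End ContinuedFractions.

Section Expansion.
Variables (A : comUnitRingType) (a b c : A).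

Local Notation z := (fpsX A).

Lemma cstirling_column n :
  Fps (cstirling c ^~ n) =
  z ^+ n * \prod_(0 <= k < n) (1 - fpsC (c *+ k.+1) * z)^-1.
Proof.
elim: n => [|n IHn].
  by rewrite big_geq // mulr1 expr0; apply: fpsP => -[|m].
have ud : 1 - fpsC (c *+ n.+1) * z \is a GRing.unit.
  by apply: fps_unit_coef0; rewrite fps_coefD fps_coefN mulrC fps_coefXM0 subr0.
apply: (mulIr ud); rewrite big_nat_recr //= !mulrA divrK // exprS -mulrA -IHn.
rewrite mulrBr mulr1 mulrCA; apply: fpsP => m.
rewrite fps_coefD fps_coefN fps_coefCM (mulrC _ z).
case: m => [|m]; first by rewrite !fps_coefXM0 mulr0 subr0.
by rewrite !fps_coefXMS /= addrK.
Qed.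

Lemma expansion_term n :
  z ^+ n * \prod_(0 <= k < n) (fpsC (a + b *+ k) / (1 - fpsC (c *+ k.+1) * z)) =
  fpsC (\prod_(0 <= k < n) (a + b *+ k)) * Fps (cstirling c ^~ n).
Proof.
rewrite big_split /= cstirling_column mulrCA; congr (_ * _).
by elim/big_rec2: _ => // k x y _ ->; rewrite fpsCM.
Qed.

Lemma expansion_coef (G : nat -> A) m :
  fps_cvg (fun N => 1 + \sum_(1 <= n < N) z ^+ n *
     \prod_(0 <= k < n) (fpsC (a + b *+ k) / (1 - fpsC (c *+ k.+1) * z)))
    (Fps G) ->
  G m = \sum_(n < m.+1) cstirling c m n * \prod_(0 <= k < n) (a + b *+ k).
Proof.
move=> /(_ m)[N0 cvgG]; rewrite -[LHS]/(Fps G m).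
rewrite -(cvgG (maxn N0 m.+1)) ?leq_maxl //.
set N := maxn _ _; have le_mN : (m.+1 <= N)%N by exact: leq_maxr.
under eq_bigr do rewrite expansion_term.
have -> : 1 = fpsC (\prod_(0 <= k < 0) (a + b *+ k)) * Fps (cstirling c ^~ 0%N).
  by rewrite -expansion_term big_geq // mulr1 expr0.
rewrite -big_ltn; last exact: leq_trans le_mN.
rewrite fps_coef_sum; under eq_bigr do rewrite fps_coefCM mulrC.
rewrite (big_cat_nat (n := m.+1)) //= big_mkord.
rewrite [X in _ + X]big_nat [X in _ + X]big1 ?addr0 // => n /andP[lt_mn _].
by rewrite cstirling_gt ?mul0r.
Qed.

End Expansion.

Theorem theorem3p5 (R : realDomainType)
    (a b c : {mpoly R[3]}) (G : nat -> {mpoly R[3]})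
    (alpha : int -> {mpoly R[3]}) :
  let z := fpsX {mpoly R[3]} in
  a = 'X_0 -> b = 'X_1 -> c = 'X_2 ->
  fps_cvg
    (fun N => 1 + \sum_(1 <= n < N) z ^+ n *
       \prod_(0 <= k < n) (fpsC (a + b *+ k) / (1 - fpsC (c *+ k.+1) * z)))
    (Fps G) ->
  alpha (- 1) = 0 ->
  (forall n : nat, alpha (2 * n%:Z) = a + b *+ n) ->
  (forall n : nat, alpha (2 * n%:Z + 1) = (c + b) *+ n.+1) ->
  [/\ eq_sfrac (Fps G) (fun k : nat => alpha k%:Z),
      eq_jfrac (Fps G)
        (fun k : nat => alpha (2 * k%:Z - 1) + alpha (2 * k%:Z))
        (fun k : nat => alpha (2 * k%:Z) * alpha (2 * k%:Z + 1)),
      x_stieltjes G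
    & x_log_convex 3 G].
Proof.
move=> z aE bE cE cvgG alphaN1 alpha_even alpha_odd.
pose s k := alpha k%:Z.
have doubleZ k : 2 * k%:Z = k.*2%:Z by lia.
have s_even k : s k.*2 = a + b *+ k by rewrite -alpha_even doubleZ.
have s_odd k : s k.*2.+1 = (c + b) *+ k.+1.
  by rewrite -alpha_odd doubleZ /s; congr alpha; lia.
have GE : G = srow s ^~ 0%N.
  apply: boolp.funext => m.
  by rewrite (expansion_coef m cvgG) (srow_stirling0 s_even s_odd).
have s_ge0 k : coef_nonneg (s k).
  rewrite -(odd_double_half k); case: (odd k); rewrite /= ?add0n ?add1n.
    rewrite s_odd cE bE; apply/coef_nonnegMn/coef_nonnegD; exact: coef_nonnegX.
  rewrite s_even aE bE; apply: coef_nonnegD; first exact: coef_nonnegX.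
  by apply: coef_nonnegMn; apply: coef_nonnegX.
have tpG : x_stieltjes G by rewrite GE; apply: xTP_srow_hankel.
split=> //; last exact: x_stieltjes_log_convex3.
  by rewrite GE; apply: srow_sfrac.
have := srow_jfrac s; rewrite -GE.
congr (eq_jfrac _ _ _); apply: boolp.funext => k.
  rewrite doubleZ /s; congr (_ + _).
  by case: k => [|k]; [rewrite -alphaN1 | congr alpha; lia].
by rewrite doubleZ /s; congr (_ * alpha _); lia.
Qed.
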